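(* Let $K\ge 2$, $n\ge K$ and $1\le m\le K-1$ be integers, and let $\nu_1,\dots,\nu_K$ be probability distributions supported on $[0,1]$ with means $\mu_1>\mu_2>\cdots>\mu_K$. Let $J_1,\dots,J_m$ be the arms accepted by the SAR (Successive Accepts and Rejects) algorithm, described in the context, run on these arms with budget $n$. Then the probability of error $$e_n=\mathbb{P}\big(\{J_1,\dots,J_m\}\neq\{1,\dots,m\}\big)$$ satisfies $$e_n\le 2K^2\exp\left(-\frac{n-K}{8\,\overline{\log}(K)\,H_2^{\langle m\rangle}}\right),$$ where $\overline{\log}(K)=\frac12+\sum_{i=2}^K\frac1i$.
   Context: Bandit model ($m$-best arms identification). There are $K$ arms, and arm $i$ has an unknown distribution $\nu_i$ on $[0,1]$ with mean $\mu_i$. At each round $t=1,\dots,n$ the agent chooses an arm $I_t$ (possibly depending on past observations) and observes a reward drawn from $\nu_{I_t}$, independently of the past given $I_t$. Write $X_{i,1},X_{i,2},\dots$ for the successive rewards obtained from arm $i$, and $\widehat\mu_{i,s}=\frac1s\sum_{t=1}^sX_{i,t}$ for the empirical mean of arm $i$ after $s$ pulls. Gaps and complexity. Define $\Delta_i^{\langle m\rangle}=\mu_i-\mu_{m+1}$ if $i\le m$, and $\Delta_i^{\langle m\rangle}=\mu_m-\mu_i$ if $i>m$. Let $(1),\dots,(K)$ be an ordering of $\{1,\dots,K\}$ such that $\Delta_{(1)}^{\langle m\rangle}\le\cdots\le\Delta_{(K)}^{\langle m\rangle}$, and set $H_2^{\langle m\rangle}=\max_{i\in\{1,\dots,K\}}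 i\,\big(\Delta_{(i)}^{\langle m\rangle}\big)^{-2}$. SAR algorithm. Let $A_1=\{1,\dots,K\}$, $m(1)=m$, $\overline{\log}(K)=\frac12+\sum_{i=2}^K\frac1i$, $n_0=0$, and for $k\in\{1,\dots,K-1\}$ let $n_k=\left\lceil\frac{1}{\overline{\log}(K)}\frac{n-K}{K+1-k}\right\rceil$. For each phase $k=1,\dots,K-1$: (1) Pull each active arm $i\in A_k$ exactly $n_k-n_{k-1}$ times (so that afterwards every arm of $A_k$ has been pulled $n_k$ times in total). (2) Let $\sigma_k:\{1,\dots,K+1-k\}\to A_k$ be a bijection with $\widehat\mu_{\sigma_k(1),n_k}\ge\widehat\mu_{\sigma_k(2),n_k}\ge\cdots\ge\widehat\mu_{\sigma_k(K+1-k),n_k}$. For $1\le r\le K+1-k$ define the empirical gaps $\widehat\Delta_{\sigma_k(r),n_k}=\widehat\mu_{\sigma_k(r),n_k}-\widehat\mu_{\sigma_k(m(k)+1),n_k}$ if $r\le m(k)$, and $\widehat\Delta_{\sigma_k(r),n_k}=\widehat\mu_{\sigma_k(m(k)),n_k}-\widehat\mu_{\sigma_k(r),n_k}$ if $r\ge m(k)+1$. (3) Let $i_k\in\arg\max_{i\in A_k}\widehat\Delta_{i,n_k}$ (ties broken arbitrarily) and deactivate it: $A_{k+1}=A_k\setminus\{i_k\}$. (4) If $\widehat\mu_{i_k,n_k}>\widehat\mu_{\sigma_k(m(k)+1),n_k}$, arm $i_k$ is accepted: set $m(k+1)=m(k)-1$ and $J_{m-m(k+1)}=i_k$; otherwise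 $i_k$ is rejected and $m(k+1)=m(k)$. Output: the accepted arms $J_1,\dots,J_m$. *)

(* Defs.v *)
From HB Require Import structures.
From mathcomp Require Import all_boot all_order all_algebra.
From mathcomp Require Import all_classical all_reals all_analysis.
Set Implicit Arguments. Unset Strict Implicit. Unset Printing Implicit Defensive.
Import Order.TTheory GRing.Theory Num.Theory.
Local Open Scope classical_set_scope.
Local Open Scope ring_scope.

Definition mutually_independent d (T : measurableType d) (R : realType)
  (P : probability T R) (I : eqType) (Y : I -> T -> R) : Prop :=
  forall (s : seq I) (B : I -> set R), uniq s ->
    (forall i, i \in s -> measurable (B i)) ->
    P (\big[setI/setT]_(i <- s) (Y i @^-1` B i)) =
    (\prod_(i <- s) P (Y i @^-1` B i))%E.

Definition mean (R : realType) (nu : probability R R) : R :=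
  fine (\int[nu]_x (x%:E))%E.

Definition logbar (R : realType) (K : nat) : R :=
  2^-1 + \sum_(2 <= i < K.+1) (i%:R)^-1.

(** Gap Delta_i^{<m>} (arms are 0-indexed: arm i : 'I_K is arm i+1 of the paper,
    so the paper's arms 1..m are the ordinals < m and arm m+1 is ordinal m). *)
Definition gap (R : realType) (K : nat) (mu : 'I_K -> R) (m : nat) (i : 'I_K) : R :=
  if (i < m)%N then mu i - nth 0 [seq mu j | j <- enum 'I_K] m
  else nth 0 [seq mu j | j <- enum 'I_K] m.-1 - mu i.

Definition H2 (R : realType) (K : nat) (mu : 'I_K -> R) (m : nat) : R :=
  let g := sort <=%R [seq gap mu m i | i <- enum 'I_K] in
  \big[Num.max/0]_(i < K) ((i.+1)%:R * (nth 0 g i) ^- 2).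

Definition nphase (R : realType) (K n k : nat) : nat :=
  if k == 0%N then 0%N else
  `| Num.ceil (((n - K)%:R : R) / (logbar R K * (K.+1 - k)%:R)) |%N.

(** Empirical mean of arm i after s pulls; X i t is the (t+1)-th reward of arm i. *)
Definition emp_mean (R : realType) (T : Type) (K : nat)
  (X : 'I_K -> nat -> T -> R) (s : nat) (i : 'I_K) (w : T) : R :=
  (s%:R)^-1 * \sum_(t < s) X i t w.

(** Empirical gap of arm i within the active set, w.r.t. a sorting s
    (s is sigma_k listed in order: nth (r-1) s = sigma_k(r)) and m active
    arms still to be accepted. *)
Definition emp_gap (R : realType) (K : nat) (mh : 'I_K -> R) (s : seq 'I_K)
  (m : nat) (i : 'I_K) : R :=
  if (index i s < m)%N then mh i - mh (nth i s m)
  else mh (nth i s m.-1) - mh i.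

(** Possible executions of SAR (all tie-breaking choices allowed), given the
    empirical means mh k i of arm i at the end of phase k (after n_k pulls).
    SAR_run mh k A m acc out : starting phase k with active set A, m arms still
    to accept, already-accepted set acc, the algorithm may output the set out.
    Convention: the phases go on while 0 < m(k) < |A_k| (when the formulas of
    the algorithm are defined); otherwise the remaining decisions are forced:
    if m(k) = 0 nothing more is accepted, if m(k) = |A_k| all remaining active
    arms are accepted. *)
Inductive SAR_run (R : realType) (K : nat) (mh : nat -> 'I_K -> R) :
  nat -> {set 'I_K} -> nat -> {set 'I_K} -> {set 'I_K} -> Prop :=
| SAR_stop (k : nat) (A : {set 'I_K}) (m : nat) (acc : {set 'I_K}) :
    ~~ ((0 < m)%N && (m < #|A|)%N) ->
    SAR_run mh k A m acc (if m == #|A| then acc :|: A else acc)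
| SAR_step (k : nat) (A : {set 'I_K}) (m : nat) (acc : {set 'I_K}) (s : seq 'I_K) (i : 'I_K) out :
    (0 < m)%N -> (m < #|A|)%N ->
    perm_eq s (enum A) ->
    sorted (fun a b => mh k b <= mh k a) s ->
    i \in A ->
    (forall j, j \in A -> emp_gap (mh k) s m j <= emp_gap (mh k) s m i) ->
    let accepted := mh k (nth i s m) < mh k i in
    SAR_run mh k.+1 (A :\ i) (if accepted then m.-1 else m)
            (if accepted then i |: acc else acc) out ->
    SAR_run mh k A m acc out.

Definition SAR_error (R : realType) (T : Type) (K n m : nat)
  (X : 'I_K -> nat -> T -> R) : set T :=
  [set w | exists out, SAR_run (fun k i => emp_mean X (nphase R K n k) i w)
                               1 [set: 'I_K]%SET m finset.set0 out
                       /\ out != [set i : 'I_K | (i < m)%N]%SET].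
Arguments SAR_error R T K n m X : clear implicits.

(* Main.v *)
(** On the event that at the end of every phase k all empirical means are within
    g / 4 of the true means, where g is the (K+1-k)-th smallest gap, no decision
    of SAR is wrong.  Indeed one of the K+1-k active arms has true gap at least g,
    and since the numbers of active arms and of remaining accepts agree with those
    of the true best arms, its empirical gap is at least g / 2.  On the other hand,
    a wrong accept (or reject) puts some good arm in the empirical bottom (some bad
    arm in the empirical top), which forces the empirical gap of the selected arm
    below g / 2.  Hoeffding's inequality and a union bound over phases and arms
    control the complement of the event. *)
Require Import Defs.
From HB Require Import structures.
From mathcomp Require Import all_boot all_order all_algebra.
From mathcomp Require Import all_classical all_reals all_analysis.
From mathcomp Require Import measurable_realfun zify lra ring.
Import Order.TTheory GRing.Theory Num.Theory.
Import numFieldNormedType.Exports.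
Local Open Scope ring_scope.
Set Implicit Arguments. Unset Strict Implicit.

(** * Correctness of SAR under accurate estimates *)

(** Otherwise the first [p] positions would hold all elements satisfying [Q], which are too many. *)
Lemma exists_index_ge (T : eqType) (s : seq T) (Q : pred T) (p : nat) :
  uniq s -> (p < count Q s)%N -> exists x, [/\ x \in s, Q x & (p <= index x s)%N].
Proof.
move=> us pQ; apply: contrapT => /forallNP H.
have : (size (seq.filter Q s) <= size (take p s))%N.
  apply: uniq_leq_size; first exact: filter_uniq.
  move=> x; rewrite mem_filter => /andP[Qx xs]; rewrite in_take //.
  by rewrite ltnNge; apply/negP => pi; apply: (H x); split.
rewrite size_filter size_take; case: ltnP; lia.
Qed.

Lemma exists_index_le (T : eqType) (s : seq T) (Q : pred T) (p : nat) :
  uniq s -> (count Q s <= p)%N -> (p < size s)%N ->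
  exists x, [/\ x \in s, ~~ Q x & (index x s <= p)%N].
Proof.
move=> us Qp ps; apply: contrapT => /forallNP H.
have : (size (take p.+1 s) <= size (seq.filter Q s))%N.
  apply: uniq_leq_size; first exact: take_uniq.
  move=> x xt; have xs := mem_take xt; rewrite mem_filter xs andbT.
  move: xt; rewrite in_take // ltnS => xp.
  by apply/negPn/negP => nQ; apply: (H x); split.
rewrite size_filter size_take; case: ltnP; lia.
Qed.

(* Q together with j has one element more than Q, so it cannot fit in the first
   [count Q s] positions. *)
Lemma exists_index_swap_out (T : eqType) (s : seq T) (Q : pred T) (j : T) :
  uniq s -> j \in s -> ~~ Q j -> (index j s < count Q s)%N ->
  exists x, [/\ x \in s, Q x & (count Q s <= index x s)%N].
Proof.
move=> us js nQj jc.
have cU : count (predU Q (pred1 j)) s = (count Q s).+1.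
  rewrite -(addn1 (count Q s)) -[1%N]/(true : nat) -js -count_uniq_mem // -count_predUI.
  rewrite [X in (_ + X)%N](_ : _ = 0%N) ?addn0 //.
  rewrite (eq_count (a2 := pred0)) ?count_pred0 // => x /=.
  by case: eqP => [->|]; rewrite ?(negbTE nQj) ?andbF.
have [||x [xs /= Qx cx]] := @exists_index_ge _ s (predU Q (pred1 j)) (count Q s) => //.
  by rewrite cU.
exists x; split => //; case/orP: Qx => // /eqP xj; move: cx; rewrite xj; lia.
Qed.

(** [Q] without [j] has too few elements to fill the first [count Q s] positions, and [j] itself
    lies beyond them. *)
Lemma exists_index_swap_in (T : eqType) (s : seq T) (Q : pred T) (j : T) :
  uniq s -> j \in s -> Q j -> (count Q s <= index j s)%N ->
  exists x, [/\ x \in s, ~~ Q x & (index x s < count Q s)%N].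
Proof.
move=> us js Qj cj.
have jsz : (index j s < size s)%N by rewrite index_mem.
have cD : count Q s = (count (predD Q (pred1 j)) s).+1.
  rewrite -(addn1 (count _ s)) -[1%N]/(true : nat) -js -count_uniq_mem // -count_predUI.
  rewrite [X in (_ + X)%N](_ : _ = 0%N) ?addn0 //.
    by apply: eq_count => x /=; case: eqP => [->|]; rewrite ?orbF ?orbT.
  by rewrite (eq_count (a2 := pred0)) ?count_pred0 // => x /=; case: eqP; rewrite ?andbF.
have [|||x [xs /= Qx cx]] := @exists_index_le _ s (predD Q (pred1 j)) (count Q s).-1 => //.
- by rewrite cD.
- lia.
exists x; split => //; last by lia.
move: Qx; rewrite negb_and negbK => /orP[/eqP xj|//]; move: cx; rewrite xj; lia.
Qed.

Lemma count_lt_nth (R : realDomainType) (g : seq R) (j : nat) :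
  sorted <=%R g -> (count (fun x => x < nth 0 g j)%R g <= j)%N.
Proof.
move=> sg; have [gj|jg] := leqP (size g) j.
  exact: leq_trans (count_size _ _) gj.
rewrite -{2}(cat_take_drop j g) count_cat (_ : count _ (drop j g) = 0%N).
  rewrite addn0; apply: leq_trans (count_size _ _) _; rewrite size_take; case: ltnP => //.
apply/eqP; rewrite -leqn0 leqNgt -has_count; apply/hasPn => x /(nthP 0)[i].
rewrite size_drop nth_drop => ig <-; rewrite -leNgt.
by apply: sorted_leq_nth => //; [exact: le_trans | rewrite inE -ltn_subRL | exact: leq_addr].
Qed.

(** At most [j] arms lie strictly below the sorted value at position [j] (counted from 0), so they
    cannot exhaust [A]. *)
Lemma nth_gap_le (R : realType) (K : nat) (f : 'I_K -> R) (A : {set 'I_K}) (j : nat) :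
  (j < #|A|)%N ->
  exists2 a, a \in A & nth 0 (sort <=%R [seq f i | i <- enum 'I_K]) j <= f a.
Proof.
move=> jA; set g := sort _ _.
apply: contrapT => /forall2NP H.
have := @count_lt_nth _ g j (sort_sorted (@le_total _ _) _).
rewrite leqNgt => /negP; apply; apply: leq_trans jA _.
rewrite /g (permP (permEl (perm_sort _ _))) count_map -size_filter cardE.
apply: uniq_leq_size; first exact: enum_uniq.
move=> a; rewrite mem_enum => aA; rewrite mem_filter mem_enum /= andbT.
by rewrite ltNge; apply/negP => ga; case: (H a).
Qed.

(** * True means and gaps *)

Section Arms.
Variables (R : realType) (K m : nat) (mu : 'I_K -> R).
Hypotheses (m_gt0 : (0 < m)%N) (m_ltK : (m < K)%N).
Hypothesis mu_decr : forall i j : 'I_K, (i < j)%N -> mu j < mu i.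

(** [om] is the best of the arms to reject and [om1] the worst of the arms to accept; every gap is
    measured against one of them. *)
Let om := Ordinal m_ltK.
Let om1 := Ordinal (leq_ltn_trans (leq_pred m) m_ltK).
Let best := [set i : 'I_K | (i < m)%N]%SET.

Lemma nth_mu (i : 'I_K) : nth 0 [seq mu j | j <- enum 'I_K] i = mu i.
Proof.
by rewrite (nth_map i) ?size_enum_ord // nth_ord_enum.
Qed.

Lemma mu_nonincr (i j : 'I_K) : (i <= j)%N -> mu j <= mu i.
Proof.
rewrite leq_eqVlt => /orP[/eqP/val_inj->//|/mu_decr/ltW//].
Qed.

Lemma mu_best i : i \in best -> mu om1 <= mu i.
Proof. by rewrite inE => im; apply: mu_nonincr => /=; lia. Qed.

Lemma mu_notbest i : i \notin best -> mu i <= mu om.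
Proof. by rewrite inE -leqNgt => im; apply: mu_nonincr. Qed.

Lemma mu_om_lt : mu om < mu om1.
Proof. by apply: mu_decr => /=; lia. Qed.

Lemma gapE i : gap mu m i = if i \in best then mu i - mu om else mu om1 - mu i.
Proof. by rewrite /gap inE -[m in nth _ _ m]/(val om) -[m.-1]/(val om1) !nth_mu. Qed.

Lemma gap_gt0 i : 0 < gap mu m i.
Proof.
have mo := mu_om_lt.
rewrite gapE; case: ifPn => [/mu_best|/mu_notbest]; lra.
Qed.

(** * Decisions within one phase *)

Section Phase.
Variables (A : {set 'I_K}) (p : nat) (mh : 'I_K -> R) (s : seq 'I_K) (e : R).
Hypotheses (p_gt0 : (0 < p)%N) (pA : (p < #|A|)%N) (bestA : #|A :&: best| = p).
Hypotheses (sA : perm_eq s (enum A)) (s_sorted : sorted (fun a b => mh b <= mh a) s).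
Hypothesis mh_dev : forall i, `|mh i - mu i| <= e.

Let us : uniq s.
Proof. by rewrite (perm_uniq sA) enum_uniq. Qed.

Let mem_s : s =i A.
Proof. by move=> x; rewrite (perm_mem sA) mem_enum. Qed.

Let size_s : size s = #|A|.
Proof. by rewrite (perm_size sA) cardE. Qed.

Let count_s : count (mem best) s = p.
Proof.
rewrite (permP sA) -bestA cardE -size_filter; apply/perm_size/uniq_perm.
- by rewrite filter_uniq // enum_uniq.
- exact: enum_uniq.
by move=> x; rewrite mem_filter !mem_enum finset.in_setI andbC.
Qed.

Let dev i : mu i - e <= mh i <= mu i + e.
Proof. by have := mh_dev i; rewrite ler_distl. Qed.

Let mh_index x y : x \in s -> y \in s -> (index x s <= index y s)%N -> mh y <= mh x.
Proof.
move=> xs ys xy; rewrite -(nth_index x xs) -(nth_index x ys).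
pose r := (fun a b => mh b <= mh a); have rt : transitive r.
  by move=> b a c; rewrite /r => h1 h2; exact: le_trans h1.
apply: (@sorted_leq_nth _ r rt _ x s s_sorted) => //; first by move=> b; exact: lexx.
all: by rewrite inE index_mem.
Qed.

(** A bad arm among the first [p] pushes some best arm [x] to position [p] or later, so the
    reference mean is at least [mh x]. The gap is then at most [mu j - mu x + 2 * e], and
    [mu j < mu x]. *)
Lemma emp_gap_wrong_accept j : j \in A -> j \notin best -> (index j s < p)%N ->
  emp_gap mh s p j < 2 * e.
Proof.
move=> jA jB js; rewrite /emp_gap js.
have [|||x []] := @exists_index_swap_out _ s (mem best) j us.
- by rewrite mem_s.
- by [].
- by rewrite count_s.
rewrite count_s => xs xB px.
have := @mh_index (nth j s p) x; rewrite mem_nth ?size_s // index_uniq ?size_s // => /(_ isT xs px).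
have := dev x; have := dev j; have := mu_om_lt; have := mu_best xB; have := mu_notbest jB; lra.
Qed.

(** Mirror image: some bad arm [x] takes one of the first [p] positions, so the reference mean at
    position [p.-1] is at most [mh x]. *)
Lemma emp_gap_wrong_reject j : j \in A -> j \in best -> (p <= index j s)%N ->
  emp_gap mh s p j < 2 * e.
Proof.
move=> jA jB js; rewrite /emp_gap ltnNge js /=.
have [|||x []] := @exists_index_swap_in _ s (mem best) j us.
- by rewrite mem_s.
- by [].
- by rewrite count_s.
rewrite count_s => xs xB px.
have p1 : (p.-1 < #|A|)%N by lia.
have := @mh_index x (nth j s p.-1); rewrite mem_nth ?size_s // index_uniq ?size_s //.
rewrite -ltnS prednK // => /(_ xs isT px).
have := dev x; have := dev j; have := mu_om_lt; have := mu_best jB; have := mu_notbest xB; lra.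
Qed.

(** The reference mean and [mh a] each cost at most [e], so at least [2 * e] of the true gap
    survives. *)
Lemma emp_gap_large a : 0 < e -> a \in A -> 4 * e <= gap mu m a -> 2 * e <= emp_gap mh s p a.
Proof.
move=> e0 aA; rewrite gapE; have as_ : a \in s by rewrite mem_s.
have p1 : (p.-1 < size s)%N by rewrite size_s; lia.
have pp : (p < size s)%N by rewrite size_s.
(* Only [p] best arms are active, so they cannot fill the first [p.+1] positions. *)
have hd : mh (nth a s p) <= mu om + e.
  have [||x [xs xB xp]] := @exists_index_le _ s (mem best) p us; rewrite ?count_s //.
  have := @mh_index x (nth a s p) xs (mem_nth _ pp); rewrite index_uniq // => /(_ xp).
  have := dev x; have := mu_notbest xB; lra.
have tl : mu om1 - e <= mh (nth a s p.-1).
  have [|x [xs xB xp]] := @exists_index_ge _ s (mem best) p.-1 us; first by rewrite count_s; lia.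
  have := @mh_index (nth a s p.-1) x (mem_nth _ p1) xs; rewrite index_uniq // => /(_ xp).
  have := dev x; have := mu_best xB; lra.
have da := dev a.
rewrite /emp_gap; case: ifPn => aB ag; case: ifPn => ai.
- lra.
(* At position [p] or later, [mh a] would be at most [mu om + e], but the true gap makes it at least
   [mu om + 3 * e]; this contradicts [0 < e]. *)
- exfalso; rewrite -leqNgt in ai.
  have := @mh_index (nth a s p) a (mem_nth _ pp) as_; rewrite index_uniq // => /(_ ai); lra.
- exfalso.
  have := @mh_index a (nth a s p.-1) as_ (mem_nth _ p1); rewrite index_uniq //.
  rewrite -ltnS prednK // => /(_ ai); lra.
- lra.
Qed.

(** The selected arm has empirical gap at least that of [a], too large for a misplaced arm. The
    accept test amounts to lying in the first [p] positions: a positive gap makes it hold there, and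
    sortedness makes it fail beyond. *)
Lemma phase_correct i : 0 < e -> (exists2 a, a \in A & 4 * e <= gap mu m a) -> i \in A ->
  (forall j, j \in A -> emp_gap mh s p j <= emp_gap mh s p i) ->
  (mh (nth i s p) < mh i) = (i \in best).
Proof.
move=> e0 [a aA ag] iA imax.
have gi : 2 * e <= emp_gap mh s p i by apply: le_trans (imax _ aA); exact: emp_gap_large.
have pp : (p < size s)%N by rewrite size_s.
have is_ : i \in s by rewrite mem_s.
have [ip|ip] := ltnP (index i s) p.
- have -> : mh (nth i s p) < mh i.
    move: gi; rewrite /emp_gap ip; lra.
  apply/esym/negPn/negP => iB; have := emp_gap_wrong_accept iA iB ip; lra.
- have -> : (mh (nth i s p) < mh i) = false.
    by apply/negbTE; rewrite -leNgt; apply: mh_index; rewrite ?mem_nth // index_uniq.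
  apply/esym/negP => iB; have := emp_gap_wrong_reject iA iB ip; lra.
Qed.

End Phase.

(** * Induction over the phases *)

Let g j := nth 0 (sort <=%R [seq gap mu m i | i <- enum 'I_K]) j.

Lemma g_gt0 j : (j < K)%N -> 0 < g j.
Proof.
move=> jK; have : g j \in [seq gap mu m i | i <- enum 'I_K].
  by rewrite -(mem_sort <=%R) mem_nth // size_sort size_map size_enum_ord.
by case/mapP => i _ ->; exact: gap_gt0.
Qed.

(** Induction on the execution. Invariant: [p] best arms are still active, and together with the
    accepted arms they form [best]. As [nth] counts from 0, [g (K - k)] is the (K+1-k)-th smallest
    gap. *)
Lemma SAR_run_correct (mh : nat -> 'I_K -> R) k A p acc out :
  (forall k' i, (0 < k')%N -> (k' < K)%N -> `|mh k' i - mu i| <= g (K - k') / 4) ->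
  SAR_run mh k A p acc out ->
  (0 < k)%N -> (#|A| + k = K.+1)%N -> #|A :&: best| = p -> (acc :|: (A :&: best))%SET = best ->
  out = best.
Proof.
move=> dev; elim=> {k A p acc out}.
- move=> k A p acc nA k0 Ak bA accU.
  (* When the phases stop, [p] is [#|A|] or 0: all active arms are best, or none is. *)
  have pA : (p <= #|A|)%N by rewrite -bA subset_leq_card // finset.subsetIl.
  case: eqP => pE.
    rewrite -accU; congr (_ :|: _)%SET; apply/esym/finset.setIidPl.
    have /eqP <- : (A :&: best)%SET == A by rewrite eqEcard finset.subsetIl bA pE leqnn.
    exact: finset.subsetIr.
  have p0 : p = 0%N by move: nA; case: p pA pE {bA} => // p; lia.
  by move: accU; rewrite p0 in bA; rewrite (cards0_eq bA) finset.setU0.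
- move=> k A p acc s i out p0 pA sA ss iA imax accepted _ IH k0 Ak bA accU.
  (* Since [0 < p < #|A|], at least two arms are still active. *)
  have kK : (k < K)%N by lia.
  have g0 : 0 < g (K - k) by apply: g_gt0; lia.
  have accE : accepted = (i \in best).
    apply: (@phase_correct A p (mh k) s (g (K - k) / 4)) => //.
    - by move=> j; exact: dev.
    - lra.
    - have [|a aA ga] := @nth_gap_le _ _ (gap mu m) A (K - k); first by lia.
      by exists a => //; rewrite mulrC divfK // pnatr_eq0.
  have cA : #|A| = #|A :\ i|.+1 by rewrite (cardsD1 i) iA.
  apply: IH => //; first by lia.
  + rewrite accE finset.setIDAC; have := cardsD1 i (A :&: best)%SET; rewrite bA.
    by rewrite !finset.in_setI iA /= inE; case: ifP => _ ->; rewrite ?add0n ?add1n.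
  + rewrite accE; apply/setP => x; have /setP/(_ x) := accU; rewrite !inE => aE.
    have [xi|xi] := eqVneq x i; first subst x.
      case: ifPn => im; first by rewrite !inE eqxx.
      by move: aE; rewrite (negbTE im) andbF !orbF.
    by case: ifPn => _; rewrite ?inE ?(negbTE xi).
Qed.

End Arms.

Local Open Scope classical_set_scope.
Local Open Scope ring_scope.

(** * Measurability of the error event *)

Lemma measure_bigU_le d (T : measurableType d) (R : realType)
  (mu : {measure set T -> \bar R}) (I : Type) (s : seq I) (A : I -> set T) :
  (forall i, measurable (A i)) ->
  (mu (\big[setU/set0]_(i <- s) A i) <= \sum_(i <- s) mu (A i))%E.
Proof.
move=> mA; elim: s => [|i s IH]; first by rewrite !big_nil measure0.
rewrite !big_cons; apply: (@le_trans _ _ (mu (A i) + mu (\big[setU/set0]_(i <- s) A i))%E).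
  by apply: measureU2 => //; exact: bigsetU_measurable.
exact: leeD2l.
Qed.

Section Run.
Context d (T : measurableType d) (R : realType) (K : nat).

Lemma measurable_set_ler (f g : T -> R) :
  measurable_fun setT f -> measurable_fun setT g -> measurable [set w | f w <= g w].
Proof. by move=> mf mg; rewrite -[X in measurable X]setTI; exact: measurable_fun_le. Qed.

Lemma measurable_set_ltr (f g : T -> R) :
  measurable_fun setT f -> measurable_fun setT g -> measurable [set w | f w < g w].
Proof.
move=> mf mg; rewrite (_ : mkset _ = ~` [set w | g w <= f w]).
  by apply: measurableC; exact: measurable_set_ler.
by apply/seteqP; split=> w /=; rewrite ltNge => /negP.
Qed.

Lemma measurable_set_and (A B : set T) :
  measurable A -> measurable B -> measurable [set w | A w /\ B w].
Proof. exact: measurableI. Qed.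

Lemma measurable_set_or (A B : set T) :
  measurable A -> measurable B -> measurable [set w | A w \/ B w].
Proof. exact: measurableU. Qed.

Lemma measurable_set_const (Q : Prop) : measurable [set _ : T | Q].
Proof.
have [q|q] := pselect Q.
  by rewrite (_ : mkset _ = setT) //; apply/seteqP; split.
by rewrite (_ : mkset _ = set0) //; apply/seteqP; split.
Qed.

(** The sorting in [SAR_run] ranges over [seq 'I_K], an infinite but countable type, so a countable
    union suffices. *)
Lemma measurable_set_exists (I : countType) (A : I -> set T) :
  (forall i, measurable (A i)) -> measurable [set w | exists i, A i w].
Proof.
move=> mA; rewrite (_ : mkset _ = \bigcup_i A i).
  by apply: countable_bigcupT_measurable.
by apply/seteqP; split=> [w [i Aw]|w [i _ Aw]]; exists i.
Qed.

Lemma measurable_set_forall (I : countType) (A : I -> set T) :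
  (forall i, measurable (A i)) -> measurable [set w | forall i, A i w].
Proof.
move=> mA; rewrite (_ : mkset _ = ~` [set w | exists i, (~` A i) w]).
  by apply/measurableC/measurable_set_exists => i; exact: measurableC.
apply/seteqP; split=> w /=; first by move=> Aw [i]; apply.
by move=> nAw i; apply: contrapT => nA; apply: nAw; exists i.
Qed.

Lemma measurable_sorted (f : 'I_K -> T -> R) (s : seq 'I_K) :
  (forall i, measurable_fun setT (f i)) ->
  measurable [set w | sorted (fun a b => f b w <= f a w) s].
Proof.
move=> mf; case: s => [|a s] /=; first exact: (measurable_set_const true).
elim: s a => [|b s IH] a /=; first exact: (measurable_set_const true).
rewrite (_ : mkset _ = [set w | f b w <= f a w /\ path (fun a b => f b w <= f a w) b s]).
  by apply: measurable_set_and (IH b); exact: measurable_set_ler.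
by apply/seteqP; split=> w /= /andP.
Qed.

Lemma measurable_emp_gap (f : 'I_K -> T -> R) (s : seq 'I_K) (p : nat) (i : 'I_K) :
  (forall i, measurable_fun setT (f i)) ->
  measurable_fun setT (fun w => emp_gap (f^~ w) s p i).
Proof. by move=> mf; rewrite /emp_gap; case: (index i s < p)%N; exact: measurable_funB. Qed.

(* The last disjunction resolves the [if accepted], so that both branches are
   measurable sets with a fixed continuation. *)
Lemma SAR_runP (mh : nat -> 'I_K -> R) k A p acc out :
  SAR_run mh k A p acc out <->
  ((~~ ((0 < p)%N && (p < #|A|)%N) /\ out = (if p == #|A| then acc :|: A else acc)%SET) \/
   exists s, exists i, ([/\ (0 < p)%N, (p < #|A|)%N, perm_eq s (enum A) & i \in A] /\
     sorted (fun a b => mh k b <= mh k a) s) /\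
     (forall j, j \in A -> emp_gap (mh k) s p j <= emp_gap (mh k) s p i) /\
     ((mh k (nth i s p) < mh k i /\ SAR_run mh k.+1 (A :\ i)%SET p.-1 (i |: acc)%SET out) \/
      (mh k i <= mh k (nth i s p) /\ SAR_run mh k.+1 (A :\ i)%SET p acc out))).
Proof.
split.
  case=> {k A p acc out} [k A p acc nA|k A p acc s i out p0 pA sA ss iA imax accepted run].
    by left.
  right; exists s, i; do 3 ?split => //; move: run; rewrite /accepted.
  by case: ltP => c run; [left|right].
case=> [[nA ->]|[s [i [[[p0 pA sA iA] ss] [imax H]]]]]; first exact: SAR_stop.
apply: (SAR_step (s := s) (i := i)) => //=.
by case: H => -[]; [move=> -> | rewrite leNgt => /negbTE ->].
Qed.

(** Each phase removes an arm, so induction on [#|A|] lets [SAR_runP] unfold the predicate one phase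
    at a time. *)
Lemma measurable_SAR_run (mh : nat -> 'I_K -> T -> R) k A p acc out :
  (forall k i, measurable_fun setT (mh k i)) ->
  measurable [set w | SAR_run (fun k i => mh k i w) k A p acc out].
Proof.
move=> mmh; move cA : #|A| => c; elim: c k A p acc cA => [|c IH] k A p acc cA.
  rewrite (_ : mkset _ =
      [set w | out = (if p == #|A| then acc :|: A else acc)%SET]).
    exact: measurable_set_const.
  apply/seteqP; split=> w /=; rewrite SAR_runP cA.
    by case=> [[_]|[s [i [[[] ]]]]].
  by left; rewrite andbF.
rewrite (eq_set (fun w => propext (SAR_runP (fun k i => mh k i w) k A p acc out))).
apply: measurable_set_or; first exact: measurable_set_const.
apply: measurable_set_exists => s; apply: measurable_set_exists => i.
(* For [i] outside [A] the event is empty; otherwise one arm fewer remains and the induction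
   hypothesis applies. *)
have [iA|iA] := boolP (i \in A); last first.
  rewrite [X in measurable X](_ : _ = set0) //; apply/seteqP; split=> w //=.
  by case=> [[[]]].
have cAi : #|(A :\ i)%SET| = c by move: cA; rewrite (cardsD1 i) iA => -[].
apply: measurable_set_and.
  by apply: measurable_set_and; [exact: measurable_set_const | exact: measurable_sorted].
apply: measurable_set_and.
  apply: measurable_set_forall => j.
  have [jA|jA] := boolP (j \in A).
    rewrite [X in measurable X](_ : _ = [set w | emp_gap ((mh k)^~ w) s p j <= emp_gap ((mh k)^~ w) s p i]).
      by apply: measurable_set_ler; exact: measurable_emp_gap.
    by apply/seteqP; split=> w //=; apply.
  by rewrite [X in measurable X](_ : _ = setT) //; apply/seteqP; split.
apply: measurable_set_or; apply: measurable_set_and; try exact: IH.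
- exact: measurable_set_ltr.
- exact: measurable_set_ler.
Qed.

End Run.

(** * Product rule for independent variables *)

Section Independence.
Import HBNNSimple.
Local Open Scope ereal_scope.
Context d (T : measurableType d) (R : realType) (P : probability T R).

(** Extension from indicators to simple functions by linearity, then to nonnegative measurable
    functions by monotone convergence. The weight [W] will hold the factors of the other
    variables. *)
Lemma integral_weighted_indic (W : T -> R) (Y : T -> R) (c : \bar R) :
  measurable_fun setT W -> (forall x, 0 <= W x)%R -> measurable_fun setT Y ->
  c \is a fin_num -> 0 <= c ->
  (forall B, measurable B -> \int[P]_x (W x * \1_B (Y x))%:E = c * P (Y @^-1` B)) ->
  forall f : R -> R, measurable_fun setT f -> (forall y, 0 <= f y)%R ->
  \int[P]_x (W x * f (Y x))%:E = c * \int[P]_x (f (Y x))%:E.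
Proof.
move=> mW W0 mY cfin c0 WB f mf f0.
have mEf : measurable_fun setT (EFin \o f) by exact/measurable_EFinP.
pose f_ := nnsfun_approx measurableT mEf.
have mfY n : measurable_fun setT (fun x => f_ n (Y x)).
  exact: (measurableT_comp (f := f_ n)).
have f_ge0 n x : (0 <= f_ n (Y x))%R by [].
have f_nd x : nondecreasing_seq (fun n => f_ n (Y x)).
  by move=> p q pq; exact/lefP/nd_nnsfun_approx.
have f_cvg x : (f_ n (Y x))%:E @[n --> \oo] --> (f (Y x))%:E.
  by apply: (@cvg_nnsfun_approx _ _ _ _ measurableT _ mEf) => // y _; rewrite lee_fin.
have simple n : \int[P]_x (W x * f_ n (Y x))%:E = c * \int[P]_x (f_ n (Y x))%:E.
  (* The weight [V] is arbitrary so as to serve both sides: [W] on the left, the constant 1 on the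
     right. *)
  have expand (V : T -> R) : measurable_fun setT V -> (forall x, 0 <= V x)%R ->
      \int[P]_x (V x * f_ n (Y x))%:E =
      \sum_(r \in range (f_ n)) (r%:E * \int[P]_x (V x * \1_(f_ n @^-1` [set r]) (Y x))%:E).
    move=> mV V0.
    have mI r : measurable_fun setT (fun x => (V x * \1_(f_ n @^-1` [set r]) (Y x))%:E).
      apply/measurable_EFinP; apply: measurable_funM => //.
      apply: measurableT_comp mY; exact: measurable_indic.
    have I0 r x : 0 <= (V x * \1_(f_ n @^-1` [set r]) (Y x))%:E.
      by rewrite lee_fin mulr_ge0.
    transitivity (\int[P]_x \sum_(r \in range (f_ n))
        (r%:E * (V x * \1_(f_ n @^-1` [set r]) (Y x))%:E)).
      apply: eq_integral => x _; rewrite fimfunE EFinM -fsumEFin // ge0_mule_fsumr.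
        by apply: eq_fsbigr => r _; rewrite !EFinM muleCA.
      by move=> r; rewrite EFinM nnfun_muleindic_ge0.
    rewrite ge0_integral_fsum //; last 2 first.
    - by move=> r; exact: measurable_funeM.
    - move=> r x _; rewrite EFinM muleCA mule_ge0 ?lee_fin //.
      by rewrite -lee_fin EFinM nnfun_muleindic_ge0.
    apply: eq_fsbigr => r; rewrite inE => -[y _ <-]; by rewrite ge0_integralZl // lee_fin.
  rewrite (expand W mW W0).
  transitivity (c * \int[P]_x (cst 1%R x * f_ n (Y x))%:E); last first.
    by congr (_ * _); apply: eq_integral => x _; rewrite mul1r.
  rewrite (expand (cst 1%R) (measurable_cst _) (fun=> ler01)) ge0_mule_fsumr; last first.
    move=> r.
    (* A negative [r] is not a value of [f_ n]: its level set is empty and its term vanishes. *)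
    have [r0|r0] := leP 0%R r.
      by rewrite mule_ge0 ?lee_fin // integral_ge0 // => x _; rewrite mul1r lee_fin.
    rewrite preimage_nnfun0 // integral0_eq ?mule0 // => x _.
    by rewrite indic0 mulr0.
  apply: eq_fsbigr => r _; rewrite WB // muleCA; congr (_ * (_ * _)).
  under eq_integral do rewrite mul1r.
  rewrite -[RHS]/(\int[P]_x (\1_(Y @^-1` (f_ n @^-1` [set r])) x)%:E).
  rewrite integral_indic ?setIT //.
  by rewrite -[_ @^-1` _]setTI; exact: mY.
have mc (V : T -> R) : measurable_fun setT V -> (forall x, 0 <= V x)%R ->
    \int[P]_x (V x * f_ n (Y x))%:E @[n --> \oo] --> \int[P]_x (V x * f (Y x))%:E.
  move=> mV V0.
  rewrite (_ : (fun x => (V x * f (Y x))%:E) =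
               (fun x => limn (fun n => (V x * f_ n (Y x))%:E))).
    apply: cvg_monotone_convergence => //.
    - by move=> n; apply/measurable_EFinP; exact: measurable_funM.
    - by move=> n x _; rewrite lee_fin mulr_ge0.
    - by move=> x _ p q pq; rewrite lee_fin ler_wpM2l // f_nd.
  apply/funext => x; apply/esym/cvg_lim => //.
  rewrite EFinM; under eq_fun do rewrite EFinM.
  exact: cvgeZl.
apply: (cvg_unique _ (mc W mW W0)) => //.
have one (h : T -> R) : \int[P]_x (h x)%:E = \int[P]_x (cst 1%R x * h x)%:E.
  by apply: eq_integral => x _; rewrite mul1r.
rewrite (_ : (fun n => _) = (fun n => c * \int[P]_x (cst 1%R x * f_ n (Y x))%:E)).
  by rewrite one; apply: cvgeZl => //; exact: (mc (cst 1%R)).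
by apply/funext => n; rewrite simple one.
Qed.

(** Independence speaks of events only. The induction therefore treats mixed products, with
    functions over [s] and indicators of arbitrary events over [t]. *)
Lemma integral_prod_indep (I : eqType) (Y : I -> T -> R) :
  (forall i, measurable_fun setT (Y i)) -> mutually_independent P Y ->
  forall (f : I -> R -> R), (forall i, measurable_fun setT (f i)) ->
  (forall i y, 0 <= f i y)%R ->
  (forall i, \int[P]_x (f i (Y i x))%:E < +oo) ->
  forall s : seq I, uniq s ->
  \int[P]_x (\prod_(i <- s) f i (Y i x))%:E = \prod_(i <- s) \int[P]_x (f i (Y i x))%:E.
Proof.
move=> mY indep f mf f0 foo s0.
have mpre i B : measurable B -> measurable (Y i @^-1` B).
  by move=> mB; rewrite -[_ @^-1` _]setTI; exact: mY.
have int_fin i : \int[P]_x (f i (Y i x))%:E \is a fin_num.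
  by rewrite ge0_fin_numE // integral_ge0 // => x _; rewrite lee_fin.
(* Replace the indicators of events by functions one index at a time. *)
suff key s t (B : I -> set R) : uniq (s ++ t) -> (forall i, measurable (B i)) ->
    \int[P]_x ((\prod_(i <- s) f i (Y i x)) * (\prod_(i <- t) \1_(B i) (Y i x)))%:E =
    (\prod_(i <- s) \int[P]_x (f i (Y i x))%:E) * (\prod_(i <- t) P (Y i @^-1` B i)).
  move=> us; have := key s0 [::] (fun=> setT); rewrite cats0 big_nil mule1 => <- //.
  by apply: eq_integral => x _; rewrite big_nil mulr1.
elim: s t B => [|i s IH] t B /= us mB.
  rewrite big_nil mul1e -indep //.
  rewrite -[in RHS](setIT (\big[_/_]_(_ <- _) _)) -integral_indic //; last first.
    by elim: (t) => [|j t' IHt]; rewrite ?big_nil ?big_cons //; apply: measurableI => //; exact: mpre.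
  apply: eq_integral => x _; rewrite big_nil mul1r; congr EFin.
  by elim: (t) => [|j t' IHt]; rewrite ?big_nil ?big_cons ?indicT // indicI IHt.
case/andP: us => ist us.
pose W x := ((\prod_(i <- s) f i (Y i x)) * (\prod_(i <- t) \1_(B i) (Y i x)))%R.
have mW : measurable_fun setT W.
  apply: measurable_funM; apply: measurable_prod => j _.
    exact: measurableT_comp.
  by apply: measurableT_comp (mY j); exact: measurable_indic.
have W0 x : (0 <= W x)%R by rewrite mulr_ge0 // prodr_ge0.
have Wc := IH t B us mB.
transitivity (\int[P]_x (W x * f i (Y i x))%:E).
  by apply: eq_integral => x _; rewrite big_cons /W -mulrA mulrC.
rewrite (@integral_weighted_indic W (Y i) (\int[P]_x (W x)%:E)) //.
- by rewrite Wc big_cons muleC muleA.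
- rewrite Wc fin_numM //.
    by elim: (s) => [|j s' IHs]; rewrite ?big_nil ?big_cons // fin_numM.
  by elim: (t) => [|j t' IHt]; rewrite ?big_nil ?big_cons // fin_numM // fin_num_measure //; exact: mpre.
- by apply: integral_ge0 => x _; rewrite lee_fin.
move=> C mC.
(* The indicator of [C] joins the events: [B'] puts [C] at index [i] and agrees with [B] on [t],
   which does not contain [i]. *)
pose B' j := if j == i then C else B j.
have eqB j : j \in t -> B' j = B j.
  by rewrite /B'; case: eqP => // -> it; move: ist; rewrite mem_cat it orbT.
have := IH (i :: t) B'; rewrite -cat1s uniq_catCA /= ist us => /(_ isT).
have mB' j : measurable (B' j) by rewrite /B'; case: ifP.
move=> /(_ mB'); rewrite !big_cons {2}/B' eqxx => e.
rewrite Wc -muleA [X in _ = _ * X]muleC.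
have -> : \prod_(j <- t) P (Y j @^-1` B j) = \prod_(j <- t) P (Y j @^-1` B' j).
  by apply: eq_big_seq => j jt; rewrite eqB.
rewrite -e; apply: eq_integral => x _; congr EFin.
rewrite big_cons {1}/B' eqxx /W -mulrA [X in (_ * X)%R = _]mulrC; congr (_ * (_ * _))%R.
by apply: eq_big_seq => j jt; rewrite eqB.
Qed.

End Independence.

(** * Hoeffding's inequality *)

Section HoeffdingLemma.
Variable R : realType.

(** The logarithm of the left side agrees with [p * l] to first order at 0, and its second
    derivative is a Bernoulli variance, at most 1/4; integrating twice gives [l ^+ 2 / 8]. *)
Lemma bernoulli_mgf_le_ge0 (p l : R) : 0 <= p -> p <= 1 -> 0 <= l ->
  1 - p + p * expR l <= expR (p * l + l ^+ 2 / 8).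
Proof.
move=> p0 p1 l0.
pose D x : R := 1 - p + p * expR x.
have D0 x : 0 < D x.
  rewrite /D; have e0 := expR_gt0 x.
  have [->|pn] := eqVneq p 0; first by lra.
  have : 0 < p by lra.
  by move=> pp; have := mulr_gt0 pp e0; lra.
have Dn x : D x != 0 by rewrite gt_eqF.
have dD (x : R) : is_derive x 1 D (p * expR x).
  rewrite /D; apply: is_derive_eq; rewrite /GRing.scale /=; ring.
(* [h] is the derivative of [p x + x^2 / 8 - ln (D x)]; its own derivative is
   [1/4 - u (1 - u)] with [u = p e^x / D x]. *)
pose h (x : R) := p + x / 4 - 1 + (1 - p) * (D x)^-1.
have dh (x : R) : is_derive x 1 h ((1 - p - p * expR x) ^+ 2 / (4 * D x ^+ 2)).
  have dV := is_deriveV (Dn x) (dD x).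
  rewrite /h; apply: is_derive_eq; rewrite /GRing.scale /=.
  rewrite /D; field; by rewrite -/(D x).
have h0 x : 0 <= x -> 0 <= h x.
  move=> x0; have <- : h 0 = 0 by rewrite /h /D expR0; field; lra.
  apply: (@ger0_derive1_ndecry _ h 0) => //.
  - move=> y _; rewrite derive1E; have [_ ->] := dh y.
    by rewrite divr_ge0 ?sqr_ge0 // mulr_ge0 // sqr_ge0.
  - apply: continuous_subspaceT => y; apply/differentiable_continuous/derivable1_diffP.
    by have [] := dh y.
(* Minus the ratio of the two sides, which avoids the logarithm; its derivative has the sign of [h],
   and [G 0] is -1. *)
pose G x := - (expR (- (p * x + x ^+ 2 / 8)) * D x).
have dG (x : R) : is_derive x 1 G (expR (- (p * x + x ^+ 2 / 8)) * D x * h x).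
  rewrite /G; apply: is_derive_eq; rewrite /GRing.scale /= /h /D.
  field; by rewrite -/(D x).
have : G 0 <= G l.
  apply: (@ger0_derive1_ndecry _ G 0) => //.
  - move=> y; rewrite in_itv /= andbT => y0; rewrite derive1E; have [_ ->] := dG y.
    by apply: mulr_ge0; [rewrite mulr_ge0 ?expR_ge0 // ltW | rewrite h0 // ltW].
  - apply: continuous_subspaceT => y; apply/differentiable_continuous/derivable1_diffP.
    by have [] := dG y.
rewrite /G /D mulr0 expr0n /= mul0r addr0 oppr0 expR0.
rewrite lerN2 expRN mul1r ler_pdivrMl ?expR_gt0 //; lra.
Qed.

(** For [l < 0] the two outcomes are exchanged: [p] becomes [1 - p], [l] becomes [- l], and [expR l]
    is factored out. *)
Lemma bernoulli_mgf_le (p l : R) : 0 <= p -> p <= 1 ->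
  1 - p + p * expR l <= expR (p * l + l ^+ 2 / 8).
Proof.
move=> p0 p1; have [l0|l0] := leP 0 l; first exact: bernoulli_mgf_le_ge0.
have := @bernoulli_mgf_le_ge0 (1 - p) (- l); rewrite subr_ge0 p1 oppr_ge0 (ltW l0) => /(_ isT).
rewrite lerBlDr lerDl p0 => /(_ isT isT).
rewrite -(ler_pM2l (expR_gt0 l)) -expRD.
rewrite (_ : l + ((1 - p) * - l + (- l) ^+ 2 / 8) = p * l + l ^+ 2 / 8); last by ring.
apply: le_trans; rewrite mulrDr mulrCA -expRD subrr expR0; lra.
Qed.

(** * Laws supported on the unit interval *)

Variables (nu : probability R R) (nu_supp : nu `[0, 1]%classic = 1%E).
Let D : set R := `[0, 1]%classic.
Let mD : measurable D. Proof. exact: measurable_itv. Qed.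

Lemma integral_support (f : R -> \bar R) : measurable_fun setT f ->
  (\int[nu]_x f x = \int[nu]_(x in D) f x)%E.
Proof.
move=> mf; rewrite [RHS]integral_mkcond; apply: ae_eq_integral => //.
- by apply: (iffLR (measurable_restrictT f mD)); exact: measurable_funTS.
exists (~` D); split; first exact: measurableC.
- by apply: etrans (probability_setC nu mD) _; rewrite nu_supp subee.
- move=> x /= nx xD; apply: nx => _. by rewrite patchE (mem_set xD).
Qed.

Let mid : measurable_fun setT (fun x : R => x%:E).
Proof. by apply/measurable_EFinP. Qed.

Let in01 x : D x -> 0 <= x <= 1.
Proof. by rewrite /D /= in_itv. Qed.

(** Two nonnegative integrals with sum 1 are finite, so the [fine] in [mean] loses nothing and the
    mean lies in [0, 1]. *)
Let integral01 : (\int[nu]_(x in D) (1 - x)%:E + \int[nu]_(x in D) x%:E = 1)%E.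
Proof.
rewrite -ge0_integralD //.
- under eq_integral do rewrite -EFinD subrK.
  by rewrite integral_cst // mul1e.
- by move=> x /in01; rewrite lee_fin => /andP[_]; rewrite subr_ge0.
- by apply/measurable_EFinP/measurable_funB.
- by move=> x /in01; rewrite lee_fin => /andP[].
Qed.

Let int_ge0 : (0 <= \int[nu]_(x in D) x%:E)%E.
Proof. by apply: integral_ge0 => x /in01 /andP[]. Qed.

Let int1_ge0 : (0 <= \int[nu]_(x in D) (1 - x)%:E)%E.
Proof. by apply: integral_ge0 => x /in01 /andP[_]; rewrite lee_fin subr_ge0. Qed.

Let intE : (\int[nu]_(x in D) x%:E)%E = (mean nu)%:E.
Proof.
rewrite /mean integral_support // fineK // ge0_fin_numE //.
by rewrite (le_lt_trans _ (ltry 1)) // -integral01 leeDr.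
Qed.

Let int1E : (\int[nu]_(x in D) (1 - x)%:E)%E = (1 - mean nu)%:E.
Proof.
by rewrite EFinB -integral01 intE addeK.
Qed.

Lemma mean_ge0 : 0 <= mean nu.
Proof. by rewrite -lee_fin -intE. Qed.

Lemma mean_le1 : mean nu <= 1.
Proof. by rewrite -subr_ge0 -lee_fin -int1E. Qed.

(** By convexity [expR (l * x)] lies below its chord on [0, 1]; integrating the chord leaves the
    Bernoulli case with parameter [mean nu]. *)
Lemma centered_mgf_le (l : R) :
  (\int[nu]_x (expR (l * (x - mean nu)))%:E <= (expR (l ^+ 2 / 8))%:E)%E.
Proof.
have mexp : measurable_fun setT (fun x : R => expR (l * (x - mean nu))).
  apply: measurableT_comp => //; apply: measurable_funM => //; exact: measurable_funB.
rewrite integral_support; last exact/measurable_EFinP.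
pose c := expR (- (l * mean nu)); have c0 : 0 <= c by exact: expR_ge0.
have e0 := expR_ge0 l.
apply: (@le_trans _ _ (\int[nu]_(x in D) (c%:E * (1 - x)%:E + (c * expR l)%:E * x%:E))%E).
  apply: ge0_le_integral => //.
  - by apply: measurable_funTS; exact/measurable_EFinP.
  - by apply/measurable_EFinP; apply: measurable_funD; apply: measurable_funM => //; exact: measurable_funB.
  move=> x /in01 /andP[x0 x1]; rewrite -!EFinM -EFinD lee_fin.
  rewrite (_ : l * (x - mean nu) = - (l * mean nu) + l * x); last by ring.
  rewrite expRD -/c -mulrA -mulrDr ler_wpM2l //.
  have := @convex_expR R (@Itv01 R x x0 x1) l 0.
  rewrite !convRE /= mulr0 addr0 expR0 /unstable.onem [x * l]mulrC; lra.
rewrite ge0_integralD //; first last.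
- by apply/measurable_EFinP; exact: measurable_funM.
- by move=> x /in01 /andP[x0 _]; rewrite -EFinM lee_fin !mulr_ge0.
- by apply/measurable_EFinP; apply: measurable_funM => //; exact: measurable_funB.
- by move=> x /in01 /andP[_ x1]; rewrite -EFinM lee_fin mulr_ge0 // subr_ge0.
rewrite ge0_integralZl_EFin //; first last.
- by apply/measurable_EFinP; exact: measurable_funB.
- by move=> x /in01 /andP[_ x1]; rewrite lee_fin subr_ge0.
rewrite ge0_integralZl_EFin //; first last.
- by rewrite mulr_ge0.
- by move=> x /in01 /andP[x0 _].
rewrite intE int1E -!EFinM -EFinD lee_fin -mulrA -mulrDr /c.
rewrite -(ler_pM2l (expR_gt0 (l * mean nu))) mulrA -expRD subrr expR0 mul1r.
rewrite -expRD [expR l * _]mulrC [l * mean nu]mulrC.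
by apply: bernoulli_mgf_le; [exact: mean_ge0 | exact: mean_le1].
Qed.

End HoeffdingLemma.

Section HoeffdingInequality.
Context d (T : measurableType d) (R : realType) (P : probability T R).
Context (I : eqType) (nu : I -> probability R R) (Y : I -> T -> R).
Hypothesis nu_supp : forall i, nu i `[0, 1]%classic = 1%E.
Hypothesis mY : forall i, measurable_fun setT (Y i).
Hypothesis Y_law : forall i (A : set R), measurable A -> P (Y i @^-1` A) = nu i A.
Hypothesis Y_indep : mutually_independent P Y.

Lemma integral_law (i : I) (f : R -> R) : measurable_fun setT f -> (forall y, 0 <= f y) ->
  (\int[P]_x (f (Y i x))%:E = \int[nu i]_y (f y)%:E)%E.
Proof.
move=> mf f0.
have := @ge0_integral_pushforward _ _ _ _ R (Y i) (mY i) P setT (EFin \o f) measurableT.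
rewrite preimage_setT => <-.
- by apply: eq_measure_integral => A mA _; exact: Y_law.
- exact/measurable_EFinP.
- by move=> y _; rewrite lee_fin.
Qed.

Lemma centered_sum_mgf_le (s : seq I) (l : R) : uniq s ->
  (\int[P]_x (expR (l * \sum_(i <- s) (Y i x - mean (nu i))))%:E <=
   (expR ((size s)%:R * (l ^+ 2 / 8)))%:E)%E.
Proof.
move=> us.
pose f i y := expR (l * (y - mean (nu i))).
have mf i : measurable_fun setT (f i).
  apply: measurableT_comp => //; apply: measurable_funM => //; exact: measurable_funB.
have fle i : (\int[P]_x (f i (Y i x))%:E <= (expR (l ^+ 2 / 8))%:E)%E.
  rewrite integral_law //; last by move=> y; exact: expR_ge0.
  exact: centered_mgf_le.
rewrite (eq_integral (fun x => (\prod_(i <- s) f i (Y i x))%:E)); last first.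
  by move=> x _; rewrite mulr_sumr expR_sum.
rewrite (integral_prod_indep mY Y_indep) //; last 2 first.
- by move=> i y; exact: expR_ge0.
- by move=> i; exact: le_lt_trans (fle i) (ltry _).
elim: s us => [|i s IH] /= us; first by rewrite big_nil mul0r expR0.
case/andP: us => _ us; rewrite big_cons.
rewrite -natr1 mulrDl mul1r addrC expRD EFinM; apply: lee_pmul (fle i) (IH us).
  by apply: integral_ge0 => x _; rewrite lee_fin expR_ge0.
elim: (s) => [|j s' IHs]; rewrite ?big_nil ?big_cons ?lee01 //; apply: mule_ge0 => //.
by apply: integral_ge0 => x _; rewrite lee_fin expR_ge0.
Qed.

Lemma measurable_centered_sum (s : seq I) :
  measurable_fun setT (fun x => \sum_(i <- s) (Y i x - mean (nu i))).
Proof. by apply: measurable_sum => i; exact: measurable_funB. Qed.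

(** Chernoff's method, with a sign [c] covering both tails. The parameter [4 * e] minimizes
    [N * (l ^+ 2 / 8 - l * e)] over [l], with minimum [- (2 * N * e ^+ 2)]. *)
Lemma hoeffding_one_sided (s : seq I) (c e : R) : uniq s -> c ^+ 2 = 1 -> 0 <= e ->
  (P [set x | (size s)%:R * e <= c * \sum_(i <- s) (Y i x - mean (nu i))]%R <=
   (expR (- (2 * (size s)%:R * e ^+ 2)))%:E)%E.
Proof.
move=> us c2 e0; set N := (size s)%:R; set A := [set _ | _].
pose S x := \sum_(i <- s) (Y i x - mean (nu i)).
have mS : measurable_fun setT S by exact: measurable_centered_sum.
have mA : measurable A.
  rewrite -[A]setTI; apply: measurable_fun_le => //; exact: measurable_funM.
have mexp : measurable_fun setT (fun x => (expR (4 * e * c * S x))%:E).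
  apply/measurable_EFinP; apply: measurableT_comp => //; exact: measurable_funM.
rewrite -[A]setIT -integral_indic //.
apply: (@le_trans _ _ (\int[P]_x ((expR (- (4 * N * e ^+ 2)))%:E * (expR (4 * e * c * S x))%:E))%E).
  apply: ge0_le_integral => //.
  - by apply/measurable_EFinP; exact: measurable_indic.
  - exact: measurable_funeM.
  move=> x _; rewrite -EFinM lee_fin -expRD indicE.
  case: (boolP (x \in A)) => [|_]; last exact: expR_ge0.
  rewrite inE => Ax; rewrite -[X in X <= _]expR0 ler_expR.
  rewrite (_ : _ + _ = 4 * e * (c * S x) - 4 * e * (N * e)); last by ring.
  by rewrite subr_ge0 ler_wpM2l // mulr_ge0.
rewrite ge0_integralZl_EFin //.
apply: (le_trans (lee_wpmul2l _ (centered_sum_mgf_le (4 * e * c) us))).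
  by rewrite lee_fin expR_ge0.
rewrite -EFinM lee_fin -expRD ler_expR -/N exprMn c2 le_eqVlt.
by apply/orP; left; apply/eqP; field.
Qed.

Lemma hoeffding_two_sided (s : seq I) (e : R) : uniq s -> 0 <= e ->
  (P [set x | (size s)%:R * e <= `|\sum_(i <- s) (Y i x - mean (nu i))|]%R <=
   (2 * expR (- (2 * (size s)%:R * e ^+ 2)))%:E)%E.
Proof.
move=> us e0; set N := (size s)%:R; set E := expR _.
pose A c := [set x | N * e <= c * \sum_(i <- s) (Y i x - mean (nu i))].
have mA c : measurable (A c).
  rewrite -[A c]setTI; apply: measurable_fun_le => //; apply: measurable_funM => //.
  exact: measurable_centered_sum.
rewrite (_ : mkset _ = A 1 `|` A (-1)).
  apply: (@le_trans _ _ (P (A 1%R) + P (A (-1)%R))%E); first exact: measureU2.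
  rewrite mulr2n mulrDl mul1r EFinD.
  by apply: leeD; apply: hoeffding_one_sided; rewrite ?expr1n ?sqrrN ?expr1n.
apply/seteqP; split=> x; rewrite /A /= mul1r mulN1r.
  by rewrite ler_normr => /orP.
by rewrite ler_normr => /orP.
Qed.

End HoeffdingInequality.

(** * The error bound *)

Lemma logbar_gt0 (R : realType) (K : nat) : 0 < logbar R K.
Proof.
by rewrite /logbar ltr_wpDr // sumr_ge0 // => i _; rewrite invr_ge0.
Qed.

Lemma nphase_ge (R : realType) (K n k : nat) : (0 < k)%N ->
  (n - K)%:R / (logbar R K * (K.+1 - k)%:R) <= (nphase R K n k)%:R :> R.
Proof.
rewrite /nphase; case: k => // k _ /=.
by rewrite natr_absz (le_trans (ceil_ge _)) // ler_int ler_norm.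
Qed.

Lemma H2_ge (R : realType) (K m : nat) (mu : 'I_K -> R) (j : nat) : (j < K)%N ->
  j.+1%:R * nth 0 (sort <=%R [seq gap mu m i | i <- enum 'I_K]) j ^- 2 <= H2 mu m.
Proof.
move=> jK.
exact: (le_bigmax 0 (fun i : 'I_K =>
  i.+1%:R * nth 0 (sort <=%R [seq gap mu m i | i <- enum 'I_K]) i ^- 2) (Ordinal jK)).
Qed.

(** Here [a] is n-K and [q] is K+1-k. The tolerance [g / 4] is the source of the 8: the right side
    is [N * g ^+ 2 / 8], at least [a / (8 * L * (q * g ^- 2))]. *)
Lemma phase_exponent_le (R : realFieldType) (a L q H g N : R) :
  0 <= a -> 0 < L -> 0 < q -> 0 < g -> q * g ^- 2 <= H -> a / (L * q) <= N ->
  a / (8 * L * H) <= 2 * N * (g / 4) ^+ 2.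
Proof.
move=> a0 L0 q0 g0 qH aN.
have g2 : 0 < g ^+ 2 by rewrite exprn_gt0.
have qg : 0 < q * g ^- 2 by rewrite mulr_gt0 // invr_gt0.
apply: (@le_trans _ _ (a / (8 * L * (q * g ^- 2)))).
  have H0 := lt_le_trans qg qH; have L8 : 0 < 8 * L by rewrite mulr_gt0.
  rewrite ler_wpM2l // lef_pV2 ?posrE; [|by apply: mulr_gt0..].
  by rewrite ler_wpM2l // mulr_ge0 // ltW.
rewrite (_ : a / _ = a / (L * q) * (g ^+ 2 / 8)); last by field; rewrite !gt_eqF.
rewrite (_ : 2 * N * _ = N * (g ^+ 2 / 8)); last by field.
by rewrite ler_wpM2r // divr_ge0 // ltW.
Qed.

(** The sum runs over pairs [(i, t)] because these index the independent family to which Hoeffding's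
    inequality is applied. *)
Lemma emp_mean_dev (R : realType) (T : Type) (K : nat) (X : 'I_K -> nat -> T -> R)
  (N : nat) (i : 'I_K) (w : T) (c : R) : (0 < N)%N ->
  `|emp_mean X N i w - c| =
  N%:R^-1 * `|\sum_(p <- [seq (i, t) | t <- iota 0 N]) (X p.1 p.2 w - c)|.
Proof.
move=> N0; have Nn : N%:R != 0 :> R by rewrite pnatr_eq0 -lt0n.
rewrite big_map /= sumrB big_const_seq count_predT size_iota iter_addr_0.
have -> : \sum_(t <- iota 0 N) X i t w = \sum_(t < N) X i t w.
  by rewrite -(big_mkord xpredT (fun t => X i t w)) /index_iota subn0.
rewrite /emp_mean -[in RHS](@ger0_norm _ (N%:R^-1)) ?invr_ge0 // -normrM.
by rewrite mulrBr -[c *+ N]mulr_natl mulKf.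
Qed.

Unset Implicit Arguments. Set Strict Implicit.

Theorem theorem1 (R : realType) (d : measure_display) (T : measurableType d)
  (P : probability T R) (K n m : nat)
  (hK : (2 <= K)%N) (hn : (K <= n)%N) (hm1 : (1 <= m)%N) (hmK : (m <= K - 1)%N)
  (nu : 'I_K -> probability R R)
  (nu_supp : forall i, nu i `[0%R, 1%R]%classic = 1%E)
  (mu_decr : forall i j : 'I_K, (i < j)%N -> mean (nu j) < mean (nu i))
  (X : 'I_K -> nat -> T -> R)
  (X_meas : forall i t, measurable_fun setT (X i t))
  (X_law : forall i t (A : set R), measurable A -> P (X i t @^-1` A) = nu i A)
  (X_indep : mutually_independent P (fun p : 'I_K * nat => X p.1 p.2)) :
  (P (SAR_error R T K n m X) <=
   (2 * (K ^ 2)%:R *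
    expR (- ((n - K)%:R /
             (8 * logbar R K * H2 (fun i => mean (nu i)) m))))%:E)%E.
Proof.
have m_ltK : (m < K)%N by lia.
set mu := fun i => mean (nu i); set E := expR _.
pose N k := nphase R K n k.
have mE : measurable (SAR_error R T K n m X).
  apply: measurable_set_exists => out; 
  apply: (measurable_set_and (A := fun w => SAR_run (fun k i => emp_mean X (N k) i w) 1
      [set: 'I_K]%SET m finset.set0 out)); last exact: measurable_set_const.
  apply: (measurable_SAR_run (mh := fun k i w => emp_mean X (N k) i w)) => k i.
  rewrite /emp_mean; apply: measurable_funM => //.
  by apply: measurable_sum => t; exact: X_meas.
(* If [n = K], every [N k] is 0 and there are no samples, but the exponential is 1 and the bound
   exceeds 1. *)
have [nK|Kn] := leqP n K.
  apply: (le_trans (probability_le1 P mE)).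
  have nK0 : (n - K = 0)%N by lia.
  rewrite lee_fin /E nK0 mul0r oppr0 expR0 mulr1 -natrM ler1n; lia.
pose g j := nth 0 (sort <=%R [seq gap mu m i | i <- enum 'I_K]) j.
have g_pos j : (j < K)%N -> 0 < g j by exact: g_gt0.
have N_gt0 k : (0 < k)%N -> (k < K)%N -> (0 < N k)%N.
  move=> k0 kK; rewrite -(ltr_nat R); apply: lt_le_trans (nphase_ge R K n k0).
  by rewrite divr_gt0 ?mulr_gt0 ?logbar_gt0 // ltr0n; lia.
pose Y (p : 'I_K * nat) := X p.1 p.2.
pose s k (i : 'I_K) := [seq (i, t) | t <- iota 0 (N k)].
have us k i : uniq (s k i) by rewrite map_inj_uniq ?iota_uniq // => a b [].
have ss k i : size (s k i) = N k by rewrite size_map size_iota.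
pose S k i w := \sum_(p <- s k i) (Y p w - mean (nu p.1)).
have mS k i : measurable_fun setT (S k i).
  by apply: (measurable_centered_sum (fun p => nu p.1)) => p; exact: X_meas.
have SE k i w : S k i w = \sum_(p <- s k i) (Y p w - mu i).
  by rewrite /S !big_map.
(* Ordinals start at 0, so [p.1] stands for phase [p.1.+1]. The inequality is non-strict to match
   Hoeffding's. *)
pose B (p : 'I_K.-1 * 'I_K) :=
  [set w | (N p.1.+1)%:R * (g (K - p.1.+1)%N / 4) <= `|S p.1.+1 p.2 w|].
have mB p : measurable (B p).
  by apply: measurable_set_ler => //; exact: measurableT_comp.
have sub : SAR_error R T K n m X `<=` \big[setU/set0]_(p : 'I_K.-1 * 'I_K) B p.
  move=> w [out [run outE]]; rewrite -bigcup_seq; apply: contrapT => nB.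
  move/eqP: outE; apply.
  (* It remains to check accuracy outside all [B p], and the invariant at the start, where all arms
     are active and none is accepted. *)
  apply: (SAR_run_correct (mu := mu) hm1 m_ltK mu_decr _ run) => //.
  - move=> k i k0 kK; have Nk := N_gt0 k k0 kK.
    rewrite emp_mean_dev // ler_pdivrMl ?ltr0n // -SE.
    rewrite leNgt; apply/negP => dev; apply: nB.
    have k1 : (k.-1 < K.-1)%N by lia.
    exists (Ordinal k1, i); first by rewrite /= mem_index_enum.
    by rewrite /B /= prednK //; exact: ltW.
  - by rewrite cardsT card_ord addn1.
  - rewrite finset.setTI -sum1dep_card -(big_ord_widen K (fun=> 1%N) (ltnW m_ltK)).
    by rewrite sum1_card card_ord.
  - by rewrite finset.setTI finset.set0U.
apply: (@le_trans _ _ (P (\big[setU/set0]_(p : 'I_K.-1 * 'I_K) B p))).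
  by apply: le_measure; rewrite ?inE //; exact: bigsetU_measurable.
apply: (le_trans (measure_bigU_le P _ mB)).
have PB p : (P (B p) <= (2 * E)%:E)%E.
  case: p => k i.
  have kK : (k.+1 < K)%N by have := ltn_ord k; lia.
  have gk : 0 < g (K - k.+1)%N by apply: g_pos; lia.
  have e0 : 0 <= g (K - k.+1)%N / 4 by rewrite divr_ge0 // ltW.
  have := @hoeffding_two_sided _ T R P _ (fun p => nu p.1) Y (fun p => nu_supp p.1)
    (fun p => X_meas p.1 p.2) (fun p => X_law p.1 p.2) X_indep (s k.+1 i) _ (us _ _) e0.
  rewrite ss => /le_trans; apply.
  rewrite lee_fin ler_pM2l // ler_expR lerN2.
  apply: (@phase_exponent_le _ _ _ (K.+1 - k.+1)%:R) => //.
  - exact: logbar_gt0.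
  - by rewrite ltr0n; lia.
  (* The gap at position [K - k.+1], counted from 0, has weight [(K - k.+1).+1] in [H2]. *)
  - rewrite (_ : (K.+1 - k.+1 = (K - k.+1).+1)%N); last by lia.
    by apply: H2_ge; lia.
  - exact: nphase_ge.
apply: (@le_trans _ _ (\sum_(p : 'I_K.-1 * 'I_K) (2 * E)%:E)%E).
  by apply: lee_sum => p _; exact: PB.
(* There are (K-1)K pairs of a phase and an arm, at most K^2. *)
rewrite sumEFin lee_fin sumr_const card_prod !card_ord -(mulr_natr (2 * E)).
rewrite mulrAC ler_wpM2r ?expR_ge0 // ler_wpM2l // ler_nat.
rewrite -mulnn leq_mul2r leq_pred orbT //.
Qed.
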